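(* Let $X$ be an irreducible affine algebraic variety over an algebraically closed field $\Bbbk$ of characteristic zero. Let $G\subseteq\mathrm{SAut}(X)$ be a subgroup generated by a saturated set $\mathcal{N}$ of locally nilpotent vector fields, which has the orbit separation property on a $G$-invariant subset $\Omega\subseteq X$. Suppose that $x_1,\dots,x_m$ and $x_1',\dots,x_m'$ are points in $\Omega$ with $x_i\ne x_j$ and $x_i'\ne x_j'$ for $i\ne j$ such that for each $j$ the orbits $G.x_j$ and $G.x_j'$ are equal and of dimension $\ge 2$. Then there exists an element $g\in G$ such that $g.x_j=x_j'$ for $j=1,\dots,m$.
   Context: Write $X=\operatorname{Spec}A$. A locally nilpotent vector field on $X$ is a $\Bbbk$-linear derivation $\partial:A\to A$ such that for every $a\in A$ there is $n$ with $\partial^n(a)=0$. It generates the subgroup $\exp(\Bbbk\partial)$ of $\mathrm{Aut}(A)\cong\mathrm{Aut}(X)$, which for $\partial\ne0$ is a one-parameter unipotent subgroup, i.e. an algebraic subgroup isomorphic to $\mathbb{G}_a$. $\mathrm{SAut}(X)$ is the subgroup of $\mathrm{Aut}(X)$ generated by all one-parameter unipotent subgroups. The group generated by a set $\mathcal{N}$ of locally nilpotent vector fields is the group generated by all $\exp(\Bbbk\partial)$, $\partial\in\mathcal{N}$. A set $\mathcal{N}$ of locally nilpotent vector fields on $X$, generating the group $G$, is saturated if (1) $\mathcal{N}$ is closed under conjugation by elements of $G$, and (2) $f\partial\in\mathcal{N}$ for all $\partial\in\mathcal{N}$ and $f\in\ker\partial$. Orbit separation property: let $\Omega\subseteq X$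 be a subset with $G.\Omega\subseteq\Omega$. A locally nilpotent vector field $\partial$ with $H=\exp(\Bbbk\partial)\subseteq G$ satisfies the orbit separation property on $\Omega$ if there is an $H$-stable subset $U(H)\subseteq\Omega$ such that (a) for each $G$-orbit $O$ contained in $\Omega$ the intersection $U(H)\cap O$ is open and dense in $O$, and (b) the global $H$-invariant regular functions $\mathcal{O}(X)^H$ separate all one-dimensional $H$-orbits in $U(H)$. (Zero-dimensional $H$-orbits are allowed in $U(H)$.) A set $\mathcal{N}$ of locally nilpotent vector fields has the orbit separation property on $\Omega$ if every $\partial\in\mathcal{N}$ does. *)

(* Defs.v *)
From HB Require Import structures.
From mathcomp Require Export all_boot all_order all_algebra.
From mathcomp Require Export boolp classical_sets functions cardinality fsbigop.
From mathcomp Require Export topology.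

Set Implicit Arguments.
Unset Strict Implicit.
Unset Printing Implicit Defensive.

Import GRing.Theory.

Local Open Scope classical_set_scope.
Local Open Scope ring_scope.

(** ** Topological notions *)

Section Topology.
Variable T : topologicalType.
Implicit Types S Z : set T.

Definition closed_in S Z := exists2 C, closed C & Z = S `&` C.

Definition open_in S Z := exists2 V, open V & Z = S `&` V.

Definition dense_in S Z := Z `<=` S /\ S `<=` closure Z.

Definition irreducible Z :=
  Z !=set0 /\
  forall C1 C2, closed C1 -> closed C2 ->
    Z `<=` C1 `|` C2 -> Z `<=` C1 \/ Z `<=` C2.

(* Krull dimension of the subspace [S]: chains Z 0 < ... < Z n of irreducible
   subsets of [S], closed in [S]; only the values [Z i] with i <= n matter. *)
Definition krull_dim_ge S (n : nat) :=
  exists Z : nat -> set T,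
    (forall i, (i <= n)%N -> irreducible (Z i) /\ closed_in S (Z i)) /\
    (forall i, (i < n)%N -> Z i `<` Z i.+1).

Definition krull_dim_eq S (n : nat) :=
  krull_dim_ge S n /\ ~ krull_dim_ge S n.+1.

End Topology.

(** ** Affine varieties *)

Definition finitely_generated (k : fieldType) (A : comAlgType k) :=
  exists s : seq A, forall S : {pred A},
    GRing.subalg_closed S -> {subset s <= S} -> forall a, a \in S.

Definition reduced (k : fieldType) (A : comAlgType k) :=
  forall (a : A) (n : nat), a ^+ n = 0 -> a = 0.

(* The closed points of Spec A for [k] algebraically closed and [A] finitely
   generated; the value of the regular function [f] at [x] is [x f]. *)
Definition points (k : fieldType) (A : comAlgType k) := {lrmorphism A -> k^o}.

Section Zariski.
Variables (k : fieldType) (A : comAlgType k).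

HB.instance Definition _ := gen_eqMixin (points A).
HB.instance Definition _ := gen_choiceMixin (points A).

Definition basic_open (f : A) : set (points A) := [set x | x f != 0].

Definition zariski_open (U : set (points A)) :=
  exists S : set A, U = \bigcup_(f in S) basic_open f.

Lemma zariski_openT : zariski_open setT.
Proof.
exists setT; apply/seteqP; split=> // x _; exists 1 => //.
by rewrite /basic_open /= rmorph1 oner_neq0.
Qed.

Lemma zariski_openI : setI_closed zariski_open.
Proof.
move=> _ _ [S ->] [S' ->]; exists [set f * g | f in S & g in S'].
apply/seteqP; split=> x.
  move=> [[f Sf fx] [g S'g gx]]; exists (f * g); first by exists f => //; exists g.
  by rewrite /basic_open /= rmorphM mulf_neq0.
move=> [_ [f Sf [g S'g <-]]]; rewrite /basic_open /= rmorphM mulf_eq0 negb_or.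
by move=> /andP[fx gx]; split; [exists f | exists g].
Qed.

Lemma zariski_open_bigU (I : Type) (U : I -> set (points A)) :
  (forall i, zariski_open (U i)) -> zariski_open (\bigcup_i U i).
Proof.
move=> /choice[S US]; exists (\bigcup_i S i); apply/seteqP; split=> x.
  by move=> [i _]; rewrite US => -[f Sf fx]; exists f => //; exists i.
by move=> [f [i _ Sf] fx]; exists i => //; rewrite US; exists f.
Qed.

HB.instance Definition _ := isOpenTopological.Build (points A)
  zariski_openT zariski_openI zariski_open_bigU.

End Zariski.

(** ** Automorphisms *)

Record algAut (k : fieldType) (A : comAlgType k) := AlgAut {
  aut_fun :> {lrmorphism A -> A};
  aut_inv : {lrmorphism A -> A};
  aut_funK : cancel aut_fun aut_inv;
  aut_invK : cancel aut_inv aut_fun }.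

Lemma lrmorphism_eq (k : fieldType) (A : comAlgType k) (B : pzSemiRingType)
    (s : k -> B -> B) (u v : {lrmorphism A -> B | s}) :
  u =1 v -> u = v.
Proof.
case: u v => u [[u1] [u2] [u3]] [v [[v1] [v2] [v3]]] /= /funext uv; subst v.
by rewrite (Prop_irrelevance u1 v1) (Prop_irrelevance u2 v2)
  (Prop_irrelevance u3 v3).
Qed.

Section AutGroup.
Variables (k : fieldType) (A : comAlgType k).
Implicit Types g h : algAut A.

HB.instance Definition _ := gen_eqMixin (algAut A).
HB.instance Definition _ := gen_choiceMixin (algAut A).

Lemma algAut_eq g h : g =1 h -> g = h.
Proof.
case: g h => [f f' fK f'K] [u u' uK u'K] /= /lrmorphism_eq fu; subst u.
have f'u' : f' = u' by apply: lrmorphism_eq => a; rewrite -{1}[a]u'K fK.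
by subst u'; congr AlgAut; apply: Prop_irrelevance.
Qed.

Definition aut_one : algAut A :=
  @AlgAut k A idfun idfun (fun=> erefl) (fun=> erefl).

Definition aut_invg g : algAut A := AlgAut (@aut_invK _ _ g) (@aut_funK _ _ g).

Definition aut_mul g h : algAut A :=
  @AlgAut k A (aut_fun g \o aut_fun h) (aut_inv h \o aut_inv g)
    (can_comp (@aut_funK _ _ g) (@aut_funK _ _ h))
    (can_comp (@aut_invK _ _ h) (@aut_invK _ _ g)).

Lemma aut_mulA : associative aut_mul.
Proof. by move=> f g h; apply: algAut_eq. Qed.

Lemma aut_mul1 : left_id aut_one aut_mul.
Proof. by move=> g; apply: algAut_eq. Qed.

Lemma aut_mulr1 : right_id aut_one aut_mul.
Proof. by move=> g; apply: algAut_eq. Qed.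

Lemma aut_mulV : left_inverse aut_one aut_invg aut_mul.
Proof. by move=> g; apply: algAut_eq => a /=; rewrite aut_funK. Qed.

Lemma aut_mulrV : right_inverse aut_one aut_invg aut_mul.
Proof. by move=> g; apply: algAut_eq => a /=; rewrite aut_invK. Qed.

HB.instance Definition _ :=
  isGroup.Build (algAut A) aut_mulA aut_mul1 aut_mulr1 aut_mulV aut_mulrV.

(* The isomorphism Aut(A) -> Aut(X) sends [g] to the automorphism of X whose
   comorphism is [g^-1], so that this is a left action. *)
Definition act g (x : points A) : points A := x \o (g^-1)%g.

Definition orbit (H : set (algAut A)) (x : points A) : set (points A) :=
  [set act h x | h in H].

Definition stable (H : set (algAut A)) (U : set (points A)) :=
  forall h x, H h -> U x -> U (act h x).

Definition subgroup (H : set (algAut A)) := group_closed (mem H).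

Definition generated (S : set (algAut A)) : set (algAut A) :=
  smallest subgroup S.

(* The regular functions invariant under [H]. *)
Definition invariants (H : set (algAut A)) : set A :=
  [set f | forall h, H h -> h f = f].

(* Images of the faithful algebraic actions of the additive group;
   [rho] is the coaction A -> A[t]. *)
Definition one_param_unipotent (H : set (algAut A)) :=
  exists (phi : k -> algAut A) (rho : {rmorphism A -> {poly A}}),
    [/\ {morph phi : s t / s + t >-> (s * t)%g},
        forall t a, phi t a = (rho a).[t%:A],
        injective phi &
        H = range phi].

Definition SAut : set (algAut A) :=
  generated (\bigcup_(H in one_param_unipotent) H).

End AutGroup.

(** ** Locally nilpotent vector fields *)

Section LND.
Variables (k : fieldType) (A : comAlgType k).
Implicit Types (d : {linear A -> A}) (G : set (algAut A)).
Implicit Types (N : set {linear A -> A}) (Omega : set (points A)).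

Definition derivation d := forall a b, d (a * b) = d a * b + a * d b.

Definition locally_nilpotent d := forall a, exists n, iter n d a = 0.

Definition lnd : set {linear A -> A} :=
  [set d | derivation d /\ locally_nilpotent d].

(* The sum runs over the indices with nonzero term, which are finite in number
   for [d] locally nilpotent. *)
Definition exp_fun d (t : k) (a : A) : A :=
  \sum_(i \in [set: nat]) (t ^+ i / i`!%:R) *: iter i d a.

Lemma exp_funE d t a n : iter n d a = 0 ->
  exp_fun d t a = \sum_(0 <= i < n) (t ^+ i / i`!%:R) *: iter i d a.
Proof.
move=> dn; rewrite /exp_fun (fsbigE (iota 0 n)) ?iota_uniq //.
  by rewrite /index_iota subn0; apply: eq_bigl => i; rewrite in_setT.
move=> i _; rewrite mem_iota /= add0n -leqNgt => /subnK <-.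
rewrite iterD dn; elim: (i - n)%N => [|j IHj]; first by rewrite scaler0.
have -> : iter j.+1 d 0 = 0 by elim: j {IHj} => /= [|j ->]; rewrite linear0.
by rewrite scaler0.
Qed.

Definition exp_group d : set (algAut A) :=
  [set g : algAut A | exists t, g =1 exp_fun d t].

Definition lnd_group N : set (algAut A) :=
  generated (\bigcup_(d in N) exp_group d).

Definition conj_lnd (g : algAut A) d : {linear A -> A} := g \o d \o (g^-1)%g.

Definition scale_lnd (f : A) d : {linear A -> A} := f \*o d.

Definition saturated N :=
  [/\ N `<=` lnd,
      forall g d, lnd_group N g -> N d -> N (conj_lnd g d) &
      forall f d, N d -> d f = 0 -> N (scale_lnd f d)].

Definition orbit_separation G Omega d :=
  exp_group d `<=` G /\
  exists U : set (points A),
    [/\ U `<=` Omega,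
        stable (exp_group d) U,
        forall x, orbit G x `<=` Omega ->
          open_in (orbit G x) (U `&` orbit G x) /\
          dense_in (orbit G x) (U `&` orbit G x) &
        forall x y, U x -> U y ->
          krull_dim_eq (orbit (exp_group d) x) 1 ->
          krull_dim_eq (orbit (exp_group d) y) 1 ->
          orbit (exp_group d) x <> orbit (exp_group d) y ->
          exists2 f, invariants (exp_group d) f & x f <> y f].

End LND.

(* Main.v *)
Require Import Defs.
From HB Require Import structures.
From mathcomp Require Import ring.

Set Implicit Arguments.
Unset Strict Implicit.
Unset Printing Implicit Defensive.

Import GRing.Theory.

Local Open Scope classical_set_scope.
Local Open Scope ring_scope.

(** Write H for the group exp(k d) of a field [d] in [N], and G_Z for the
    pointwise stabiliser in G of a finite set Z of points.

    The group G is generated by images of the affine line, so it behaves like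
    an irreducible variety.  Call a function on G regular if it is polynomial
    along every polynomial curve of G, and a property of elements of G generic
    if it holds wherever some regular function, not identically zero on G, is
    nonzero.  Finitely many generic properties hold together
    ([regular_irreducible]); hence a single element of G moves finitely many
    given points into the open sets U(H).

    Points are moved by replicas.  If y and the points of Z lie in U(H), and
    the H-orbit of y differs from those of the points of Z, then some F in
    ker d is zero on Z and nonzero at y, and the flow of F d fixes Z while
    pushing y along its H-orbit ([replica_move]).

    To use this one has to know that, for y <> z in one orbit O of dimension at
    least 2, a generic c in G brings y and z to different H-orbits
    ([indist_eq]).  Let y and z be equivalent when f (c y) = f (c z) for all c
    in G and all f in ker d; this relation is G-invariant.  If it is not
    equality at x, there is exactly one flow line through x inside the class of
    x ([indist_line]), and every field of [N] flows along it: otherwise a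
    replica would fix one point of the class and push x out of the class
    ([indist_flow]).  So O would be a single flow line, of dimension 1.

    A regular function which vanishes at c^-1 exp(t d) c h for generic c also
    vanishes for c = 1.  This makes a subset of G dense as soon as it is stable
    under generic conjugates of the flows ([generic_dense]).  If y is
    outside Z and G y has dimension at least 2, it follows that G_Z y is dense
    in G y ([fixes_dense]), and that, for each g in G, the points c y and g c y
    are in one G_Z-orbit for generic c ([generic_fixes_transitive]).

    Finally let w = g y, with y and w outside Z.  By density there is a c
    fixing both Z and g^-1 Z such that g c y is in G_Z c y = G_Z y.  But
    g c y = (g c g^-1) w, and g c g^-1 fixes Z; so w is in G_Z y
    ([fixes_transitive]).  The theorem follows by moving the points one after
    the other, each time fixing those already in place. *)

(** * Exponentials of locally nilpotent derivations *)

Section Exponential.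
Variables (k : fieldType) (char0 : [pchar k] =i pred0) (A : comAlgType k).
Implicit Types (d : {linear A -> A}) (a b : A) (s t : k).

Lemma natr_neq0 n : (0 < n)%N -> n%:R != 0 :> k.
Proof. by move: char0 => /pcharf0P ->; case: n. Qed.

Lemma factr_neq0 n : n`!%:R != 0 :> k.
Proof. exact/natr_neq0/fact_gt0. Qed.

Definition divpow d n a : A := n`!%:R^-1 *: iter n d a.

Lemma divpow0 d a : divpow d 0 a = a.
Proof. by rewrite /divpow /= invr1 scale1r. Qed.

Lemma iter_linear d n s a b :
  iter n d (s *: a + b) = s *: iter n d a + iter n d b.
Proof. by elim: n => //= n ->; rewrite linearP. Qed.

Lemma divpow_linear d n : linear (divpow d n).
Proof.
by move=> s a b; rewrite /divpow iter_linear scalerDr !scalerA mulrC.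
Qed.

Lemma divpowS d n a : d (divpow d n a) = n.+1%:R *: divpow d n.+1 a.
Proof.
rewrite /divpow linearZ iterS scalerA; congr (_ *: _).
by rewrite factS natrM invfM mulVKf ?natr_neq0.
Qed.

Lemma divpow_comp d i j a :
  divpow d i (divpow d j a) = 'C(i + j, j)%:R *: divpow d (i + j) a.
Proof.
have iterZ n s b : iter n d (s *: b) = s *: iter n d b.
  by elim: n => //= n ->; rewrite linearZ.
rewrite /divpow iterZ -iterD !scalerA; congr (_ *: _).
apply: (mulIf (factr_neq0 (i + j))); rewrite mulfVK ?factr_neq0 //.
have := @bin_fact (i + j) j (leq_addl _ _); rewrite addnK => <-.
rewrite !natrM; field; by rewrite !factr_neq0.
Qed.

Lemma divpowM d n a b : derivation d ->
  divpow d n (a * b) = \sum_(i < n.+1) divpow d i a * divpow d (n - i) b.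
Proof.
move=> dM; elim: n => [|n IHn]; first by rewrite big_ord1 !divpow0.
apply: (scalerI (natr_neq0 (ltn0Sn n))); rewrite -divpowS IHn.
rewrite linear_sum /= scaler_sumr.
under eq_bigr => i _ do rewrite dM !divpowS -subSn ?leq_ord //.
rewrite big_split /=.
have -> : \sum_(i < n.+2) n.+1%:R *: (divpow d i a * divpow d (n.+1 - i) b) =
    \sum_(i < n.+2) i%:R *: (divpow d i a * divpow d (n.+1 - i) b) +
    \sum_(i < n.+2) (n.+1 - i)%:R *: (divpow d i a * divpow d (n.+1 - i) b).
  rewrite -big_split; apply: eq_bigr => i _ /=.
  by rewrite -scalerDl -natrD subnKC // leq_ord.
congr (_ + _).
  rewrite [RHS]big_ord_recl scale0r add0r; apply: eq_bigr => i _ /=.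
  by rewrite scalerAl subSS.
rewrite [RHS]big_ord_recr /= subnn scale0r addr0; apply: eq_bigr => i _ /=.
by rewrite scalerAr.
Qed.

(** The coaction a |-> exp(T d) a with values in A[T]; the bound of the sum is
    an exponent of [d] that kills [a]. *)
Definition exp_poly d a : {poly A} :=
  \poly_(i < xget 0%N [set n | iter n d a = 0]) divpow d i a.

Lemma coef_exp_poly d a i : locally_nilpotent d ->
  (exp_poly d a)`_i = divpow d i a.
Proof.
move=> /(_ a) dnil; rewrite coef_poly; case: ltnP => // ni; symmetry.
have dn : iter (xget 0%N [set n | iter n d a = 0]) d a = 0.
  exact: (@xgetPex _ 0%N [set n | iter n d a = 0] dnil).
rewrite /divpow -(subnK ni) iterD dn.
have -> : iter (i - xget 0%N [set n | iter n d a = 0]) d 0 = 0.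
  by elim: (i - _)%N => //= j ->; rewrite linear0.
by rewrite scaler0.
Qed.

Lemma exp_fun_poly d t a : locally_nilpotent d ->
  exp_fun d t a = (exp_poly d a).[t%:A].
Proof.
move=> dnil.
have dn : iter (xget 0%N [set n | iter n d a = 0]) d a = 0.
  exact: (@xgetPex _ 0%N [set n | iter n d a = 0] (dnil a)).
rewrite (exp_funE _ dn) horner_poly big_mkord; apply: eq_bigr => i _.
by rewrite /divpow exprZn expr1n mulr_algr scalerA.
Qed.

Lemma exp_polyP d s a b : locally_nilpotent d ->
  exp_poly d (s *: a + b) = s%:A *: exp_poly d a + exp_poly d b.
Proof.
move=> dnil; apply/polyP => i.
by rewrite coefD coefZ !coef_exp_poly // divpow_linear mulr_algl.
Qed.

Lemma exp_poly_mul d : lnd d -> {morph exp_poly d : a b / a * b}.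
Proof.
move=> [dM dnil] a b; apply/polyP => i.
rewrite coefM coef_exp_poly // divpowM //.
by apply: eq_bigr => j _; rewrite !coef_exp_poly.
Qed.

Lemma deriv1 d : derivation d -> d 1 = 0.
Proof.
move=> dM; have := dM 1 1; rewrite !mulr1 mul1r -[LHS]addr0.
by move/addrI.
Qed.

Lemma divpow1 d n : derivation d -> divpow d n.+1 1 = 0.
Proof.
move=> dM; rewrite /divpow iterSr deriv1 //.
have -> : iter n d 0 = 0 by elim: n => //= n ->; rewrite linear0.
by rewrite scaler0.
Qed.

Section Flow.
Variables (d : {linear A -> A}) (d_lnd : lnd d) (t : k).

(** [exp_fun d t] tagged with the proof that makes it an algebra morphism. *)
Definition exp_lnd of lnd d := exp_fun d t.

Let expE a : exp_lnd d_lnd a = (exp_poly d a).[t%:A].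
Proof. by apply: exp_fun_poly; case: d_lnd. Qed.

Lemma exp_lnd_is_linear : linear (exp_lnd d_lnd).
Proof.
move=> s a b; rewrite !expE exp_polyP; last by case: d_lnd.
by rewrite hornerD hornerZ mulr_algl.
Qed.

Lemma exp_lnd_is_monoid_morphism : monoid_morphism (exp_lnd d_lnd).
Proof.
split=> [|a b]; last by rewrite !expE exp_poly_mul // hornerM.
rewrite expE; suff -> : exp_poly d 1 = 1 by rewrite hornerC.
case: d_lnd => dM dnil; apply/polyP => -[|i]; rewrite coef_exp_poly // coef1.
  by rewrite divpow0.
by rewrite divpow1.
Qed.

HB.instance Definition _ :=
  GRing.isLinear.Build k A A _ (exp_lnd d_lnd) exp_lnd_is_linear.
HB.instance Definition _ :=
  GRing.isMonoidMorphism.Build A A (exp_lnd d_lnd) exp_lnd_is_monoid_morphism.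

Definition exp_lrmorph : {lrmorphism A -> A} := exp_lnd d_lnd.

End Flow.

(** Taylor's formula for [exp_poly d a], whose divided derivatives are the
    polynomials [exp_poly d (divpow d i a)]. *)
Lemma exp_funD d s t a : lnd d ->
  exp_fun d s (exp_fun d t a) = exp_fun d (s + t) a.
Proof.
move=> d_lnd; have [_ dnil] := d_lnd.
rewrite [RHS]exp_fun_poly // scalerDl nderiv_taylor; last exact: mulrC.
rewrite [exp_fun d t a]exp_fun_poly // horner_coef.
have := linear_sum (exp_lrmorph d_lnd s).
rewrite /exp_lrmorph /= /exp_lnd => ->; apply: eq_bigr => i _.
rewrite coef_exp_poly // exprZn expr1n !mulr_algr.
have := linearZ_LR (exp_lrmorph d_lnd s).
rewrite /exp_lrmorph /= /exp_lnd => ->.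
rewrite exp_fun_poly //; congr (_ *: _.[_]).
apply/polyP => j; rewrite coef_nderivn !coef_exp_poly // divpow_comp addnC.
by rewrite scaler_nat.
Qed.

Lemma exp_fun0 d a : lnd d -> exp_fun d 0 a = a.
Proof.
move=> [_ dnil].
by rewrite exp_fun_poly // scale0r horner_coef0 coef_exp_poly // divpow0.
Qed.

Lemma exp_funK d t (d_lnd : lnd d) :
  cancel (exp_lrmorph d_lnd t) (exp_lrmorph d_lnd (- t)).
Proof. by move=> a; rewrite /= /exp_lnd exp_funD // addNr exp_fun0. Qed.

Lemma exp_funNK d t (d_lnd : lnd d) :
  cancel (exp_lrmorph d_lnd (- t)) (exp_lrmorph d_lnd t).
Proof. by move=> a; rewrite /= /exp_lnd exp_funD // subrr exp_fun0. Qed.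

(** The sign makes [exp_aut d t] act on points by precomposition with
    exp(t d), because [act] inverts automorphisms.  The definition is total so
    that no proof of [lnd d] occurs in statements. *)
Definition exp_aut d t : algAut A :=
  if pselect (lnd d) is left d_lnd
  then AlgAut (@exp_funNK d t d_lnd) (@exp_funK d t d_lnd) else 1%g.

Lemma exp_autE d t a : lnd d -> exp_aut d t a = exp_fun d (- t) a.
Proof. by rewrite /exp_aut; case: pselect. Qed.

Lemma exp_aut0 d : lnd d -> exp_aut d 0 = 1%g.
Proof.
by move=> d_lnd; apply: algAut_eq => a; rewrite exp_autE // oppr0 exp_fun0.
Qed.

Lemma exp_autD d s t : lnd d ->
  exp_aut d (s + t) = (exp_aut d s * exp_aut d t)%g.
Proof.
move=> d_lnd; apply: algAut_eq => a.
rewrite [RHS]exp_autE //= [exp_aut d t a]exp_autE // exp_funD // -opprD.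
by rewrite exp_autE.
Qed.

Lemma exp_autV d t : lnd d -> ((exp_aut d t)^-1 = exp_aut d (- t))%g.
Proof.
move=> d_lnd; apply: (mulgI (exp_aut d t)).
by rewrite mulgV -exp_autD // subrr exp_aut0.
Qed.

End Exponential.

Section Action.
Variables (k : fieldType) (A : comAlgType k).
Implicit Types (g h : algAut A) (x y : points A) (a : A).

Lemma actM g h x : act (g * h)%g x = act g (act h x).
Proof. by apply: lrmorphism_eq. Qed.

Lemma act1 x : act 1%g x = x.
Proof. by apply: lrmorphism_eq. Qed.

Lemma actK g : cancel (@act k A g) (act g^-1%g).
Proof. by move=> x; rewrite -actM mulVg act1. Qed.

Lemma actVK g : cancel (act g^-1%g) (@act k A g).
Proof. by move=> x; rewrite -actM mulgV act1. Qed.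

Lemma act_inj g : injective (@act k A g).
Proof. exact: can_inj (actK g). Qed.

Lemma actE g x a : act g x a = x (g^-1%g a).
Proof. by []. Qed.

End Action.

(** * Polynomial functions on the line *)

Section PolynomialFunctions.
Variables (k : fieldType).

Definition poly_fun (h : k -> k) := exists P : {poly k}, forall u, h u = P.[u].

Lemma poly_fun_cst c : poly_fun (fun=> c).
Proof. by exists c%:P => u; rewrite hornerC. Qed.

Lemma poly_funM h1 h2 : poly_fun h1 -> poly_fun h2 ->
  poly_fun (fun u => h1 u * h2 u).
Proof. by move=> [P hP] [Q hQ]; exists (P * Q) => u; rewrite hornerM hP hQ. Qed.

Lemma poly_funB h1 h2 : poly_fun h1 -> poly_fun h2 ->
  poly_fun (fun u => h1 u - h2 u).
Proof.
by move=> [P hP] [Q hQ]; exists (P - Q) => u; rewrite hornerD hornerN hP hQ.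
Qed.

Lemma poly_fun_zeros h (s : nat -> k) : poly_fun h -> injective s ->
  (forall n, h (s n) = 0) -> forall u, h u = 0.
Proof.
move=> [P hP] s_inj hs0 u; rewrite hP; suff -> : P = 0 by rewrite horner0.
apply/eqP; apply: contraT => P0.
have := @max_poly_roots _ P (map s (iota 0 (size P))) P0.
rewrite size_map size_iota ltnn => -> //.
  by apply/allP => _ /mapP[n _ ->]; rewrite /root -hP hs0.
by rewrite map_inj_uniq ?iota_uniq.
Qed.

Hypothesis char0 : [pchar k] =i pred0.

Lemma natr_inj : injective (fun n : nat => n%:R : k).
Proof.
move=> m n /= mn; wlog lt_mn : m n mn / (m < n)%N.
  by move=> wlg; case: (ltngtP m n) => // nm;
    [apply: wlg | symmetry; apply: wlg].
have := natr_neq0 char0 (_ : 0 < n - m)%N; rewrite subn_gt0 => /(_ lt_mn).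
by rewrite natrB 1?ltnW // mn subrr eqxx.
Qed.

(** The line is irreducible, since it is infinite: otherwise all natural numbers
    would be roots of the product. *)
Lemma poly_fun_neq0 h1 h2 u1 u2 : poly_fun h1 -> poly_fun h2 ->
  h1 u1 != 0 -> h2 u2 != 0 -> exists u, h1 u != 0 /\ h2 u != 0.
Proof.
move=> [P hP] [Q hQ]; rewrite hP hQ => P1 Q2.
have PQ : P * Q != 0.
  by rewrite mulf_neq0 //; [move: P1|move: Q2]; apply: contra => /eqP->;
    rewrite horner0.
apply: contrapT => no.
suff /eqP: P * Q = 0 by rewrite (negPf PQ).
apply/eqP; apply: contraT => _.
have := @max_poly_roots _ (P * Q)
  [seq n%:R | n <- iota 0 (size (P * Q))] PQ.
rewrite size_map size_iota ltnn => -> //.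
  apply/allP => _ /mapP[n _ ->]; rewrite /root hornerM; apply: contraT.
  rewrite mulf_eq0 negb_or => /andP[? ?].
  by case: no; exists n%:R; rewrite hP hQ.
by rewrite map_inj_uniq ?iota_uniq //; exact: natr_inj.
Qed.

End PolynomialFunctions.

Lemma point_alg (k : fieldType) (A : comAlgType k) (x : points A) (u : k) :
  x u%:A = u.
Proof. by rewrite linearZ /= rmorph1; exact: mulr1. Qed.

Lemma poly_fun_point (k : fieldType) (A : comAlgType k) (x : points A)
    (F : {poly A}) :
  poly_fun (fun u => x F.[u%:A]).
Proof.
exists (map_poly (x : A -> k) F) => u.
by rewrite -[u in RHS](point_alg x) horner_map.
Qed.

(** * Generic elements of the group *)

Section Generic.
Variables (k : fieldType) (char0 : [pchar k] =i pred0) (A : comAlgType k).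
Variables (N : set {linear A -> A}) (N_lnd : N `<=` @lnd k A).
Let G := lnd_group N.
Implicit Types (d : {linear A -> A}) (f : A) (s t u : k) (g h c : algAut A).
Implicit Types (phi : algAut A -> k) (theta : k -> algAut A) (x p q : points A).
Local Notation ex := (exp_aut char0).

Lemma lnd_group_closed : group_closed (mem G).
Proof.
split=> [|g h]; rewrite !in_setE.
  by move=> M [[M1 _] _]; move: M1; rewrite in_setE.
move=> Gg Gh M [Mgrp NM]; have [_ /(_ g h)] := Mgrp; rewrite !in_setE.
by apply; [apply: Gg | apply: Gh].
Qed.

Lemma lnd_group1 : G 1%g.
Proof. by have [] := lnd_group_closed; rewrite in_setE. Qed.

Lemma lnd_groupV g : G g -> G (g^-1)%g.
Proof. by have /group_closedV /(_ g) := lnd_group_closed; rewrite !in_setE. Qed.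

Lemma lnd_groupM g h : G g -> G h -> G (g * h)%g.
Proof.
by have /group_closedM /(_ g h) := lnd_group_closed; rewrite !in_setE.
Qed.

Lemma lnd_group_exp d t : N d -> G (ex d t).
Proof.
move=> Nd M [_ NM]; apply: NM; exists d => //; exists (- t) => a.
exact/exp_autE/N_lnd.
Qed.

Lemma exp_groupP d g : lnd d -> exp_group d g <-> exists t, g = ex d t.
Proof.
move=> d_lnd; split=> [[t gE]|[t ->]].
  by exists (- t); apply: algAut_eq => a; rewrite gE exp_autE // opprK.
by exists (- t) => a; rewrite exp_autE.
Qed.

Lemma lnd_group_ind (P : set (algAut A)) :
  P 1%g -> (forall g h, G g -> G h -> P g -> P h -> P (g * h)%g) ->
  (forall g, G g -> P g -> P (g^-1)%g) -> (forall d t, N d -> P (ex d t)) ->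
  G `<=` P.
Proof.
move=> P1 PM PV PN g Gg.
suff [] : (G `&` P) g by [].
apply: Gg; split; first split.
- by rewrite in_setE; split=> //; apply: lnd_group1.
- move=> h1 h2; rewrite !in_setE => -[G1 Ph1] [G2 P2]; split.
    by apply: lnd_groupM => //; exact: lnd_groupV.
  by apply: PM => //; [exact: lnd_groupV|exact: PV].
- move=> h [d Nd /exp_groupP[|t ->]]; first exact: N_lnd.
  by split; [exact: lnd_group_exp|exact: PN].
Qed.

Definition poly_family theta := forall f, exists F : {poly A},
  forall u, theta u f = F.[u%:A].

(** The inverse family is part of the definition in order that conjugation by a
    moving element, c^-1 g c, preserve polynomial curves. *)
Definition poly_curve theta :=
  [/\ forall u, G (theta u), poly_family theta &
      poly_family (fun u => (theta u)^-1)%g].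

Lemma poly_familyM theta eta : poly_family theta -> poly_family eta ->
  poly_family (fun u => theta u * eta u)%g.
Proof.
move=> /choice[T TE] etaP f; have [F FE] := etaP f.
exists (\sum_(i < size F) T F`_i * 'X^i) => u.
rewrite /= FE horner_coef linear_sum horner_sum /=; apply: eq_bigr => i _.
by rewrite hornerM hornerXn rmorphM rmorphXn /= linearZ /= rmorph1 TE.
Qed.

Lemma poly_curveM theta eta : poly_curve theta -> poly_curve eta ->
  poly_curve (fun u => theta u * eta u)%g.
Proof.
move=> [GT T1 T2] [GE E1 E2]; split=> [u||]; first exact: lnd_groupM.
  exact: poly_familyM.
by under eq_fun do rewrite invgM; exact: poly_familyM.
Qed.

Lemma poly_curveV theta : poly_curve theta ->
  poly_curve (fun u => (theta u)^-1)%g.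
Proof.
by move=> [GT T1 T2]; split=> // u; exact: lnd_groupV.
Qed.

Lemma poly_curve_cst g : G g -> poly_curve (fun=> g).
Proof.
move=> Gg; split=> // f; first by exists (g f)%:P => u; rewrite hornerC.
by exists (g^-1%g f)%:P => u; rewrite hornerC.
Qed.

Lemma poly_curve_exp d : N d -> poly_curve (ex d).
Proof.
move=> Nd; have d_lnd := N_lnd Nd; have [_ dnil] := d_lnd.
split=> [u|f|f]; first exact: lnd_group_exp.
  exists (exp_poly d f \Po - 'X) => u.
  by rewrite exp_autE // exp_fun_poly // horner_comp hornerN hornerX scaleNr.
exists (exp_poly d f) => u.
by rewrite exp_autV // exp_autE // opprK exp_fun_poly.
Qed.

(** A substitute for the coordinate ring of the ind-group G. *)
Definition regular phi := forall theta, poly_curve theta ->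
  poly_fun (fun u => phi (theta u)).

Lemma regular_cst s : regular (fun=> s).
Proof. by move=> theta _; apply: poly_fun_cst. Qed.

Lemma regularM phi psi : regular phi -> regular psi ->
  regular (fun g => phi g * psi g).
Proof.
by move=> rphi rpsi theta Pt; apply: poly_funM; [exact: rphi|exact: rpsi].
Qed.

Lemma regularB phi psi : regular phi -> regular psi ->
  regular (fun g => phi g - psi g).
Proof.
by move=> rphi rpsi theta Pt; apply: poly_funB; [exact: rphi|exact: rpsi].
Qed.

Lemma regular_act f x : regular (fun g => act g x f).
Proof.
move=> theta [_ _ /(_ f)[F FE]]; have [P PE] := poly_fun_point x F.
by exists P => u; rewrite -PE actE FE.
Qed.

Lemma regular_transl phi g h : G g -> G h -> regular phi ->
  regular (fun c => phi (g * c * h))%g.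
Proof.
move=> Gg Gh rphi theta Pt.
apply: (rphi (fun u => g * theta u * h)%g); apply: poly_curveM.
  by apply: poly_curveM => //; exact: poly_curve_cst.
exact: poly_curve_cst.
Qed.

Lemma regular_conj phi g h : G g -> G h -> regular phi ->
  regular (fun c => phi (c^-1 * g * c * h))%g.
Proof.
move=> Gg Gh rphi theta Pt.
apply: (rphi (fun u => (theta u)^-1 * g * theta u * h)%g).
apply: (poly_curveM _ (poly_curve_cst Gh)); apply: (poly_curveM _ Pt).
by apply: (poly_curveM _ (poly_curve_cst Gg)); exact: poly_curveV.
Qed.

(** The element [b * a^-1] is a word in the flows, and it suffices to treat a
    word of length one.  There a point where [phi] is nonzero and a point where
    [psi] is nonzero lie on the polynomial curve u |-> exp(u d) a, and the line
    is irreducible.  Longer words are handled by translating [psi]. *)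
Lemma regular_irreducible phi psi a b : regular phi -> regular psi ->
  G a -> G b -> phi a != 0 -> psi b != 0 ->
  exists c, [/\ G c, phi c != 0 & psi c != 0].
Proof.
move=> rphi rpsi Ga Gb pa pb.
pose P g := forall phi psi a, regular phi -> regular psi -> G a ->
  phi a != 0 -> psi (g * a)%g != 0 ->
  exists c, [/\ G c, phi c != 0 & psi c != 0].
suff /(_ (b * a^-1)%g) GP : G `<=` P.
  apply: (GP _ phi psi a) => //; last by rewrite mulgVK.
  by apply: lnd_groupM => //; exact: lnd_groupV.
apply: lnd_group_ind => {phi psi a b rphi rpsi Ga Gb pa pb}.
- by move=> phi psi a _ _ Ga; rewrite mul1g; exists a.
- move=> g h Gg Gh Pg Ph phi psi a rphi rpsi Ga pa pb.
  have rpsi' : regular (fun c => psi (g * c)%g).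
    have := regular_transl Gg lnd_group1 rpsi.
    by under eq_fun do rewrite mulg1.
  have [|c [Gc pc qc]] := Ph phi (fun c => psi (g * c)%g) a rphi rpsi' Ga pa.
    by rewrite mulgA.
  exact: (Pg phi psi c).
- move=> g Gg Pg phi psi a rphi rpsi Ga pa pb.
  have [||c [Gc pc qc]] := Pg psi phi (g^-1 * a)%g rpsi rphi _ pb.
  + by apply: lnd_groupM => //; exact: lnd_groupV.
  + by rewrite mulVKg.
  by exists c.
- move=> d t Nd phi psi a rphi rpsi Ga pa pb.
  have Pt := poly_curveM (poly_curve_exp Nd) (poly_curve_cst Ga).
  have [||u [? ?]] :=
    poly_fun_neq0 char0 (u1 := 0) (u2 := t) (rphi _ Pt) (rpsi _ Pt).
  + by rewrite exp_aut0 ?mul1g //; exact: N_lnd.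
  + by [].
  exists (ex d u * a)%g; split=> //.
  by apply: lnd_groupM => //; exact: lnd_group_exp.
Qed.

Definition generic : set_system (algAut A) := fun P =>
  exists phi, [/\ regular phi, exists2 a, G a & phi a != 0 &
    forall c, G c -> phi c != 0 -> P c].

Global Instance generic_filter : ProperFilter generic.
Proof.
split; first by move=> [phi [_ [a Ga pa] /(_ a Ga pa)]].
split.
- exists (fun=> 1); split=> //; first exact: regular_cst.
  by exists 1%g; [exact: lnd_group1|exact: oner_neq0].
- move=> P Q [phi [rphi [a Ga pa] phiP]] [psi [rpsi [b Gb pb] psiQ]].
  exists (fun c => phi c * psi c); split; first exact: regularM.
    have [c [Gc pc qc]] := regular_irreducible rphi rpsi Ga Gb pa pb.
    by exists c => //; rewrite mulf_neq0.
  move=> c Gc; rewrite mulf_eq0 negb_or.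
  by move=> /andP[/(phiP _ Gc) ? /(psiQ _ Gc)].
- move=> P Q PQ [phi [rphi ex_a phiP]]; exists phi; split=> // c Gc pc.
  exact/PQ/phiP.
Qed.

Lemma generic_group : generic G.
Proof.
exists (fun=> 1); split=> //; first exact: regular_cst.
by exists 1%g; [exact: lnd_group1|exact: oner_neq0].
Qed.

Lemma generic_transl P g h : G g -> G h -> generic P ->
  generic [set c | P (g * c * h)%g].
Proof.
move=> Gg Gh [phi [rphi [a Ga pa] phiP]].
exists (fun c => phi (g * c * h)%g); split; first exact: regular_transl.
  exists (g^-1 * a * h^-1)%g; last by rewrite !mulgA mulgV mul1g mulgVK.
  apply: (lnd_groupM _ (lnd_groupV Gh)).
    by apply: (lnd_groupM _ Ga); exact: lnd_groupV.
move=> c Gc pc; apply: phiP => //.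
by apply: (lnd_groupM _ Gh); exact: lnd_groupM.
Qed.

Lemma generic_neq0 phi a : regular phi -> G a -> phi a != 0 ->
  generic [set c | phi c != 0].
Proof. by move=> rphi Ga pa; exists phi; split=> //; exists a. Qed.

Lemma regular_eq0 phi : regular phi -> generic [set c | phi c = 0] ->
  forall c, G c -> phi c = 0.
Proof.
move=> rphi phi0 c Gc; apply: contrapT => /eqP pc.
have [b [/= pb qb]] := filter_ex (filterI phi0 (generic_neq0 rphi Gc pc)).
by rewrite pb eqxx in qb.
Qed.

(** Let [phi] vanish on [K].  For [h] in [K] the regular function
    c |-> phi (c^-1 exp(t d) c h) vanishes generically, hence everywhere; at
    [c = 1] it shows that the translate of [phi] by exp(t d) vanishes on [K] as
    well.  Iterating, all translates of [phi] vanish at 1, so [phi = 0]. *)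
Lemma generic_dense (K P : set (algAut A)) : K 1%g ->
  (forall h d t, K h -> N d -> generic [set c | K (c^-1 * ex d t * c * h)%g]) ->
  K `<=` G -> generic P -> exists2 h, K h & P h.
Proof.
move=> K1 Kconj KG [phi [rphi [a Ga pa] phiP]].
suff [h Kh ph] : exists2 h, K h & phi h != 0.
  by exists h => //; apply: phiP => //; exact: KG.
apply: contrapT => noh; move/eqP: pa; apply; move: a Ga.
pose Z g := forall phi, regular phi -> (forall h, K h -> phi h = 0) ->
  (forall h, K h -> phi (g * h)%g = 0).
suff GZ : G `<=` [set g | Z g /\ Z g^-1%g].
  move=> a Ga; have [Za _] := GZ a Ga.
  rewrite -(mulg1 a); apply: Za => // h Kh.
  by apply: contrapT => /eqP ph; apply: noh; exists h.
have ZM g h : G g -> Z g -> Z h -> Z (g * h)%g.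
  move=> Gg Zg Zh psi rpsi psi0 l Kl; rewrite -mulgA.
  apply: (Zh (fun c => psi (g * c)%g)) => //; last exact: Zg.
  have := regular_transl Gg lnd_group1 rpsi.
  by under eq_fun do rewrite mulg1.
have Zexp d t : N d -> Z (ex d t).
  move=> Nd psi rpsi psi0 h Kh.
  have rconj := regular_conj (lnd_group_exp t Nd) (KG _ Kh) rpsi.
  have := regular_eq0 rconj _ lnd_group1; rewrite invg1 mul1g mulg1; apply.
  by apply: filterS (Kconj h d t Kh Nd) => c Kc /=; apply: psi0.
apply: lnd_group_ind.
- by split=> psi _ psi0 h Kh; rewrite ?invg1 mul1g psi0.
- move=> g h Gg Gh [Zg ZgV] [Zh ZhV]; split; first exact: ZM.
  by rewrite invgM; apply: ZM => //; exact: lnd_groupV.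
- by move=> g Gg [? ?]; split=> //; rewrite invgK.
- move=> d t Nd; split; first exact: Zexp.
  by rewrite exp_autV; [exact: Zexp|exact: N_lnd].
Qed.

End Generic.

(** * Zariski closed sets and flow lines *)

Section Zeros.
Variables (k : fieldType) (A : comAlgType k).
Implicit Types (f : A) (x y : points A) (C S : set (points A)).

Lemma pointB x (a b : A) : x (a - b) = x a - x b.
Proof. exact: rmorphB. Qed.

Lemma pointM x (a b : A) : x (a * b) = x a * x b.
Proof. exact: rmorphM. Qed.

Lemma pointZ x (s : k) (a : A) : x (s *: a) = s * x a.
Proof. exact: linearZ. Qed.

Definition vanishes f S := forall y, S y -> y f = 0.

Definition zclosed C := forall x, (forall f, vanishes f C -> x f = 0) -> C x.

Lemma closed_zero f : closed [set y : points A | y f = 0].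
Proof.
rewrite -openC; exists [set f]; rewrite bigcup_set1.
by apply/seteqP; split=> y /= /eqP.
Qed.

Lemma zclosed_separate C x : zclosed C -> ~ C x ->
  exists2 f, vanishes f C & x f != 0.
Proof.
move=> zC nCx; apply: contrapT => no; apply/nCx/zC => f fC.
by apply: contrapT => /eqP xf; apply: no; exists f.
Qed.

Lemma closed_zclosed C : closed C -> zclosed C.
Proof.
rewrite -openC => -[S CS] x xC; apply: contrapT => nCx.
have : (~` C) x by [].
rewrite CS => -[f Sf /eqP]; apply; apply: xC => y Cy.
apply: contrapT => /eqP yf; have : (~` C) y by rewrite CS; exists f.
by apply.
Qed.

Lemma zclosed_closed C : zclosed C -> closed C.
Proof.
move=> zC; rewrite -openC; exists [set f | vanishes f C].
apply/seteqP; split=> y.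
  by move=> /(zclosed_separate zC)[f fC yf]; exists f.
by move=> [f fC] /eqP yf /fC.
Qed.

Lemma zclosed1 x : zclosed [set x].
Proof.
move=> y yx; apply: lrmorphism_eq => a; apply/eqP; rewrite -subr_eq0; apply/eqP.
have := yx (a - (x a)%:A); rewrite pointB point_alg; apply => _ ->.
by rewrite pointB point_alg subrr.
Qed.

Lemma irreducible_prime S f g : irreducible S -> vanishes (f * g) S ->
  vanishes f S \/ vanishes g S.
Proof.
move=> [_ Sirr] fgS.
have [y /fgS|fS|gS] := Sirr _ _ (@closed_zero f) (@closed_zero g).
- by rewrite rmorphM => /eqP; rewrite mulf_eq0 => /orP[] /eqP; [left|right].
- by left.
- by right.
Qed.

Lemma prime_irreducible S : S !=set0 -> (forall f g, vanishes (f * g) S ->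
  vanishes f S \/ vanishes g S) -> irreducible S.
Proof.
move=> S0 Sprime; split=> // C1 C2 /closed_zclosed C1c /closed_zclosed C2c SC.
apply: contrapT => /not_orP[/existsNP[x /not_implyP[Sx nC1x]]].
move=> /existsNP[y /not_implyP[Sy nC2y]].
have [f fC1 xf] := zclosed_separate C1c nC1x.
have [g gC2 yg] := zclosed_separate C2c nC2y.
have [z Sz|/(_ x Sx)|/(_ y Sy)] := Sprime f g.
- by rewrite pointM; case: (SC z Sz) => [/fC1|/gC2] ->; rewrite ?mul0r ?mulr0.
- by apply/eqP.
- by apply/eqP.
Qed.

Lemma point_horner y (P : {poly k}) (s : A) :
  y (map_poly (in_alg A) P).[s] = P.[y s].
Proof.
rewrite !horner_coef size_map_poly linear_sum; apply: eq_bigr => i _ /=.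
by rewrite rmorphM rmorphXn coef_map /= point_alg.
Qed.

End Zeros.

Section Lines.
Variables (k : fieldType) (char0 : [pchar k] =i pred0) (A : comAlgType k).
Variables (d : {linear A -> A}) (d_lnd : lnd d).
Implicit Types (f a : A) (s t u : k) (x y p q : points A).
Local Notation ex := (exp_aut char0).

(** The tangent vector [x \o d] of the flow at [x] is nonzero. *)
Definition moving x := exists a, x (d a) != 0.

Definition line x : set (points A) := range (fun t => act (ex d t) x).

Lemma act_exp t x a : act (ex d t) x a = x (exp_fun d t a).
Proof. by rewrite actE exp_autV // exp_autE // opprK. Qed.

Lemma line_refl x : line x x.
Proof. by exists 0 => //; rewrite exp_aut0 // act1. Qed.

Lemma line_orbit x : orbit (exp_group d) x = line x.
Proof.
apply/seteqP; split=> y.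
  by move=> [g /(exp_groupP char0 _ d_lnd)[t ->] <-]; exists t.
move=> [t _ <-]; exists (ex d t) => //.
by apply/(exp_groupP char0 _ d_lnd); exists t.
Qed.

Lemma line_trans x y : line x y -> line y = line x.
Proof.
move=> [t _ <-]; apply/seteqP; split=> z [u _ <-].
  by exists (u + t) => //; rewrite exp_autD // actM.
by exists (u - t) => //; rewrite -actM -exp_autD // subrK.
Qed.

Lemma line_poly f x : poly_fun (fun t => act (ex d t) x f).
Proof.
have [_ dnil] := d_lnd; have [P PE] := poly_fun_point x (exp_poly d f).
by exists P => t; rewrite act_exp exp_fun_poly // PE.
Qed.

Lemma not_moving_iter x i a : ~ moving x -> (0 < i)%N -> x (iter i d a) = 0.
Proof.
case: i => // i nx _; apply: contrapT => /eqP xi; apply: nx.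
by exists (iter i d a).
Qed.

Lemma act_exp_slice t x b : (forall i, (1 < i)%N -> x (iter i d b) = 0) ->
  act (ex d t) x b = x b + t * x (d b).
Proof.
move=> xb; have [_ /(_ b)[n dn]] := d_lnd.
have dn2 : iter n.+2 d b = 0 by rewrite !iterS dn !linear0.
rewrite act_exp (exp_funE _ dn2) big_nat_recl // big_nat_recl // !linearD /=.
rewrite linear_sum big1_seq ?addr0 => [|i _].
  by rewrite !invr1 expr0 expr1 !mulr1 scale1r linearZ.
by rewrite linearZ /= -!iterS xb // scaler0.
Qed.

Lemma not_moving_fixed t x : ~ moving x -> act (ex d t) x = x.
Proof.
move=> nx; apply: lrmorphism_eq => a.
rewrite act_exp_slice => [|i i1]; last first.
  by apply: not_moving_iter => //; apply: ltnW.
by rewrite -[d a]/(iter 1 d a) not_moving_iter // mulr0 addr0.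
Qed.

Lemma not_moving_line x : ~ moving x -> line x = [set x].
Proof.
move=> nx; apply/seteqP; split=> y.
  by move=> [t _ <-]; rewrite not_moving_fixed.
by move=> ->; exact: line_refl.
Qed.

(** A last nonzero term of the sequence of the [x (d^i a)], [i > 0], provides a
    [b] with [x (d b) != 0] on which the flow from [x] is affine in the time;
    normalising [b] gives a function which reads off the time. *)
Lemma moving_slice x : moving x -> exists s : A, forall t, act (ex d t) x s = t.
Proof.
move=> [a xa].
suff [b xb0 xb] : exists2 b, x (d b) != 0 &
    forall i, (1 < i)%N -> x (iter i d b) = 0.
  exists ((x (d b))^-1 *: (b - (x b)%:A)) => t.
  rewrite pointZ pointB point_alg act_exp_slice //.
  by rewrite [x b + _]addrC addrK mulrC mulfK.
have [_ /(_ a)[n dn]] := d_lnd.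
have {xa} : exists2 i, (0 < i)%N & x (iter i d a) != 0 by exists 1%N.
elim: n a dn => [|n IHn] a dn [i i0 xi].
  have a0 : a = 0 by [].
  have i0E : iter i d 0 = 0 by elim: (i) => //= ? ->; rewrite linear0.
  move: xi; rewrite a0 i0E.
  by rewrite linear0 eqxx.
have [da|no] :=
  pselect (exists2 i, (0 < i)%N & x (iter i d (d a)) != 0).
  by apply: (IHn (d a)) => //; rewrite -iterSr.
have xa j : (1 < j)%N -> x (iter j d a) = 0.
  case: j => [|[|j]] // _; apply: contrapT => /eqP xj; apply: no.
  exists j.+1 => //.
  by rewrite -iterSr.
exists a => //; case: i i0 xi => [|[|i]] // _.
by rewrite xa // eqxx.
Qed.

Lemma line_inj x : moving x -> injective (fun t => act (ex d t) x).
Proof.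
move=> /moving_slice[s xs] t u /= tu.
by rewrite -(xs t) tu xs.
Qed.

Lemma moving_line x y : line x y -> moving x -> moving y.
Proof.
move=> xy mx; apply: contrapT => /not_moving_line.
rewrite (line_trans xy) => xE.
have eq_y t : act (ex d t) x = y.
  have : line x (act (ex d t) x) by exists t.
  by rewrite xE.
have /(line_inj mx)/eqP : act (ex d 0) x = act (ex d 1) x by rewrite !eq_y.
by rewrite eq_sym oner_eq0.
Qed.

(** Orbits of the additive group are closed: with [s] reading off the time, the
    line is defined by the equations [a = P_a(s)], where [P_a] is the polynomial
    that gives [a] along the line. *)
Lemma line_zclosed x : zclosed (line x).
Proof.
have [mx|/not_moving_line->] := pselect (moving x); last exact: zclosed1.
have [s xs] := moving_slice mx; move=> p px; exists (p s) => //.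
apply: lrmorphism_eq => a; have [P PE] := line_poly a x.
have := px (a - (map_poly (in_alg A) P).[s]).
rewrite pointB point_horner PE => /(_ _)/subr0_eq ->// _ [t _ <-].
by rewrite pointB point_horner PE xs subrr.
Qed.

Lemma line_sub_zclosed (s : nat -> k) x C : zclosed C -> injective s ->
  (forall n, C (act (ex d (s n)) x)) -> line x `<=` C.
Proof.
move=> zC s_inj sC _ [t _ <-]; apply: zC => f fC.
by apply: (poly_fun_zeros (line_poly f x) s_inj) => n; apply: fC.
Qed.

Lemma line_generic_sub f x p C : zclosed C -> line x p -> p f != 0 ->
  (forall q, line x q -> q f != 0 -> C q) -> line x `<=` C.
Proof.
move=> zC [t _ <-] ptf fC _ [u _ <-]; apply: zC => g gC.
apply: contrapT => /eqP ug.
have [v [vf vg]] := poly_fun_neq0 char0 (line_poly f x) (line_poly g x) ptf ug.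
have /gC/eqP : C (act (ex d v) x) by apply: fC => //; exists v.
by rewrite (negPf vg).
Qed.

Lemma line_irreducible x : irreducible (line x).
Proof.
apply: prime_irreducible; first by exists x; apply: line_refl.
move=> f g fg; apply: contrapT => /not_orP[].
move=> /existsNP[p /not_implyP[[t _ <-] /eqP tf]].
move=> /existsNP[q /not_implyP[[u _ <-] /eqP ug]].
have [v [vf vg]] := poly_fun_neq0 char0 (line_poly f x) (line_poly g x) tf ug.
have /eqP : act (ex d v) x (f * g) = 0 by apply: fg; exists v.
by rewrite pointM mulf_eq0 (negPf vf) (negPf vg).
Qed.

(** In a chain Z0 < Z1 < Z2 inside a line, Z1 has only finitely many points, as
    a function vanishing on Z1 but not on Z2 is a nonzero polynomial in the
    time.  Being irreducible, Z1 is a point, so that Z0 = Z1. *)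
Lemma line_dim_lt2 S x : S `<=` line x -> ~ krull_dim_ge S 2.
Proof.
move=> Sx [Z [Zirr Zlt]].
have [irr1 [C1 C1cl Z1E]] := Zirr 1%N isT.
have [irr0 [C0 C0cl Z0E]] := Zirr 0%N isT.
have [_ [C2 _ Z2E]] := Zirr 2%N isT.
have [Z01 /existsNP[p /not_implyP[Z1p nZ0p]]] := Zlt 0%N isT.
have [_ /existsNP[w /not_implyP[Z2w nZ1w]]] := Zlt 1%N isT.
have Sw : S w by move: Z2w; rewrite Z2E => -[].
have nC1w : ~ C1 w by move=> C1w; apply: nZ1w; rewrite Z1E.
have [f fC1 wf] := zclosed_separate (closed_zclosed C1cl) nC1w.
have fC : vanishes f (Z 1%N) by move=> y; rewrite Z1E => -[_ /fC1].
have Z1x : Z 1%N `<=` line x by move=> y; rewrite Z1E => -[/Sx].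
have [q Z0q] := irr0.1.
apply: nZ0p; suff -> : p = q by [].
have Z1q := Z01 _ Z0q.
have [mx|/not_moving_line xE] := pselect (moving x); last first.
  by move: (Z1x _ Z1p) (Z1x _ Z1q); rewrite xE => -> ->.
have [s xs] := moving_slice mx.
have [P PE] := line_poly f x.
have P0 : P != 0.
  have [t _ wE] := Sx _ Sw; apply: contra wf => /eqP P0.
  by rewrite -wE PE P0 horner0.
have PZ : vanishes (map_poly (in_alg A) P).[s] (Z 1%N).
  move=> y Z1y; have [t _ yE] := Z1x _ Z1y; rewrite point_horner -yE xs -PE yE.
  exact: fC.
suff [r rZ] : exists r, vanishes (s - r%:A) (Z 1%N).
  have Z1_r y : Z 1%N y -> y = act (ex d r) x.
    move=> Z1y; have [t _ yE] := Z1x _ Z1y; have := rZ _ Z1y.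
    by rewrite -yE pointB point_alg xs => /subr0_eq ->.
  by rewrite (Z1_r p) // (Z1_r q).
(* Peel off the linear factors of P one at a time. *)
have [n] := ubnP (size P); elim: n P {PE} P0 PZ => // n IHn P P0 PZ szP.
have /factor_theorem[Q PE] : root P (q s).
  by apply/eqP; rewrite -point_horner PZ.
have Q0 : Q != 0 by apply: contra P0 => /eqP Q0; rewrite PE Q0 mul0r.
have PE' : (map_poly (in_alg A) P).[s] =
    (map_poly (in_alg A) Q).[s] * (s - (q s)%:A).
  by rewrite PE rmorphM /= hornerM map_polyXsubC hornerXsubC.
rewrite PE' in PZ; have [QZ|] := irreducible_prime irr1 PZ.
  apply: (IHn Q) => //.
  by move: szP; rewrite PE size_Mmonic ?monicXsubC // size_XsubC addn2.
by move=> ?; exists (q s).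
Qed.

Lemma line_dim1 x : moving x -> krull_dim_eq (line x) 1.
Proof.
move=> mx; split; last by apply: (@line_dim_lt2 _ x).
exists (fun i => if i is 0%N then [set x] else line x); split.
  move=> [|i] _; split.
  - split; first by exists x.
    by move=> C1 C2 _ _ /(_ x erefl)[]; [left|right] => _ ->.
  - exists [set x]; first by apply: zclosed_closed; exact: zclosed1.
    by rewrite setIidr // => _ ->; exact: line_refl.
  - exact: line_irreducible.
  - by exists setT; [exact: closedT|rewrite setIT].
move=> [|//] _; split; first by move=> _ ->; exact: line_refl.
have x1 : line x (act (ex d 1) x) by exists 1.
move=> /(_ _ x1) /= x1E.
have /(line_inj mx)/eqP : act (ex d 1) x = act (ex d 0) x.
  by rewrite x1E exp_aut0 // act1.
by rewrite oner_eq0.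
Qed.

End Lines.

(** * Conjugates, replicas and invariants *)

Section Replicas.
Variables (k : fieldType) (char0 : [pchar k] =i pred0) (A : comAlgType k).
Implicit Types (f a : A) (s t u : k) (x y p q : points A) (g : algAut A).
Implicit Types (d : {linear A -> A}).
Local Notation ex := (exp_aut char0).

Lemma exp_conj g d t : lnd d -> lnd (conj_lnd g d) ->
  ex (conj_lnd g d) t = (g * ex d t * g^-1)%g.
Proof.
move=> d_lnd c_lnd; apply: algAut_eq => a; rewrite exp_autE //.
have [_ /(_ (g^-1%g a))[n dn]] := d_lnd.
have iterE i : iter i (conj_lnd g d) a = g (iter i d (g^-1%g a)).
  elim: i => [|i /= ->]; first by rewrite /= aut_invK.
  by rewrite /conj_lnd /= aut_funK.
have cn : iter n (conj_lnd g d) a = 0 by rewrite iterE dn linear0.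
rewrite (exp_funE _ cn).
have -> : (g * ex d t * g^-1)%g a = g (ex d t (g^-1%g a)) by [].
rewrite exp_autE // (exp_funE _ dn) linear_sum; apply: eq_bigr => i _ /=.
by rewrite iterE linearZ.
Qed.

(** Powers of [F] come out of the iterates of [F d], so that the replica moves
    [x] along the same line as [d], with the speed multiplied by [x F]. *)
Lemma act_replica d F t x : lnd d -> d F = 0 -> lnd (scale_lnd F d) ->
  act (ex (scale_lnd F d) t) x = act (ex d (t * x F)) x.
Proof.
move=> d_lnd dF s_lnd; apply: lrmorphism_eq => a; rewrite !act_exp //.
have [dM /(_ a)[n dn]] := d_lnd.
have iterE i : iter i (scale_lnd F d) a = F ^+ i * iter i d a.
  elim: i => [|i /= ->]; first by rewrite mul1r.
  rewrite /scale_lnd /=; have dFi : d (F ^+ i) = 0.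
    elim: i => [|i IHi]; first exact: deriv1.
    by rewrite exprS dM dF IHi mul0r mulr0 addr0.
  by rewrite dM dFi mul0r add0r mulrA exprS.
have sn : iter n (scale_lnd F d) a = 0 by rewrite iterE dn mulr0.
rewrite (exp_funE _ sn) (exp_funE _ dn) !linear_sum; apply: eq_bigr => i _ /=.
rewrite iterE !linearZ /= rmorphM rmorphXn /= exprMn.
by rewrite -[LHS]/(_ * (_ * _)) -[RHS]/(_ * _); ring.
Qed.

(** By induction on the order of nilpotency: [d f] is invariant too, so
    [d (d f) = 0], and then exp(d) f = f + d f. *)
Lemma exp_invariant d f : lnd d -> exp_fun d 1 f = f -> d f = 0.
Proof.
move=> d_lnd; have [_ /(_ f)[n dn]] := d_lnd.
elim: n f dn => [|n IHn] f dn fE; first by rewrite -[f]/(iter 0 d f) dn linear0.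
have ddf : d (d f) = 0.
  apply: IHn; first by rewrite -iterSr.
  have dn' : iter n d (d f) = 0 by rewrite -iterSr.
  rewrite (exp_funE _ dn') -[in RHS]fE (exp_funE _ (_ : iter n.+1 d f = 0)) //.
  have dn1 : d (iter n d f) = 0 := dn.
  rewrite big_nat_recr //= linearD linear_sum linearZ /= dn1 scaler0 addr0.
  by apply: eq_bigr => i _; rewrite linearZ -iterSr.
have : exp_fun d 1 f = f + d f.
  have dn2 : iter 2 d f = 0 by rewrite /= ddf.
  rewrite (exp_funE _ dn2) big_nat_recl // big_nat1 /=.
  by rewrite expr0 expr1 !divr1 !scale1r.
by rewrite fE -[LHS]addr0 => /addrI.
Qed.

Lemma invariant_exp d f t x : lnd d -> d f = 0 -> act (ex d t) x f = x f.
Proof.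
move=> d_lnd df; rewrite act_exp // (exp_funE _ (_ : iter 1 d f = 0)) //.
by rewrite big_nat1 expr0 divr1 scale1r.
Qed.

(** Two lines that share infinitely many points coincide, both being closed. *)
Lemma line_sub_eq d e x y : lnd d -> lnd e -> moving d x ->
  line char0 d x `<=` line char0 e y -> line char0 d x = line char0 e y.
Proof.
move=> d_lnd e_lnd mx sub; apply/seteqP; split=> //.
have /choice[s sE] : forall n : nat, exists s,
    act (ex e s) y = act (ex d n%:R) x.
  move=> n; have [|s _ sE] := sub (act (ex d n%:R) x); last by exists s.
  by exists n%:R.
apply: (line_sub_zclosed e_lnd (s := s)); first exact: line_zclosed.
  move=> m n mn; apply: (natr_inj char0); apply: (line_inj d_lnd mx) => /=.
  by rewrite -!sE mn.
by move=> n; rewrite sE; exists n%:R.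
Qed.

End Replicas.

(** * Moving points by replicas *)

Section Separation.
Variables (k : fieldType) (char0 : [pchar k] =i pred0) (A : comAlgType k).
Variables (N : set {linear A -> A}) (N_sat : saturated N).
Let G := lnd_group N.
Variables (Omega : set (points A)) (Omega_inv : stable G Omega).
Hypothesis N_sep : forall d, N d -> orbit_separation G Omega d.
Implicit Types (f a : A) (s t u : k) (x y z p q : points A) (g h c : algAut A).
Implicit Types (d e : {linear A -> A}) (U : set (points A)).
Local Notation ex := (exp_aut char0).
Local Notation line := (line char0).
Local Notation gen := (generic N).

Lemma sat_lnd : N `<=` @lnd k A. Proof. by case: N_sat. Qed.
Let N_lnd := sat_lnd.
#[local] Instance gen_filter : ProperFilter gen := generic_filter char0 N_lnd.

Let G1 : G 1%g := @lnd_group1 k A N.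
Let GM g h : G g -> G h -> G (g * h)%g := @lnd_groupM k A N g h.
Let GV g : G g -> G (g^-1)%g := @lnd_groupV k A N g.
Let Gex d t : N d -> G (ex d t) := fun Nd => lnd_group_exp char0 N_lnd t Nd.

Lemma sat_conj g d : G g -> N d -> N (conj_lnd g d).
Proof. by case: N_sat => _ + _; apply. Qed.

Lemma sat_scale F d : N d -> d F = 0 -> N (scale_lnd F d).
Proof. by case: N_sat => _ _; apply. Qed.

Lemma lnd_group_conj c g : G c -> G g -> G (c^-1 * g * c)%g.
Proof. by move=> Gc Gg; apply: GM => //; apply: GM => //; exact: GV. Qed.

Lemma orbit_act g x : G g -> orbit G (act g x) = orbit G x.
Proof.
move=> Gg; apply/seteqP; split=> y [h Gh <-].
  by exists (h * g)%g; rewrite ?actM //; exact: GM.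
by exists (h * g^-1)%g; [apply: GM => //; exact: GV|rewrite actM actK].
Qed.

Definition separated d U := forall x y, U x -> U y ->
  moving d x -> moving d y -> line d x <> line d y ->
  exists2 f, d f = 0 & x f <> y f.

Definition moves_orbit d x := exists2 c, G c & moving d (act c x).

(** On each orbit where [d] does not vanish, [U] and the locus where [d] is
    nonzero contain together a nonempty principal open subset; principal opens
    are what regular functions on the group see. *)
Lemma separated_good d : N d -> exists2 U, separated d U &
  forall x, Omega x -> moves_orbit d x ->
  exists f, (exists2 b, G b & act b x f != 0) /\
    forall p, orbit G x p -> p f != 0 -> U p /\ moving d p.
Proof.
move=> Nd; have d_lnd := N_lnd Nd.
have [_ [U [UO _ Uopen Usep]]] := N_sep Nd; exists U.
  move=> x y Ux Uy mx my xy.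
  have [|||f finv] := Usep x y Ux Uy.
  - by rewrite (line_orbit char0 d_lnd); exact: line_dim1.
  - by rewrite (line_orbit char0 d_lnd); exact: line_dim1.
  - by rewrite !(line_orbit char0 d_lnd).
  exists f => //; apply: exp_invariant => //.
  have := finv (ex d (-1)); rewrite exp_autE // opprK; apply.
  by apply/(exp_groupP char0 _ d_lnd); exists (-1).
move=> x Ox [c Gc [a ca]].
have [|[V Vop VE] [_ dense]] := Uopen x.
  by move=> _ [h Gh <-]; exact: Omega_inv.
have [p [[Up Op] _]] : (U `&` orbit G x) `&` setT !=set0.
  by apply: (dense x) filterT; exists 1%g; rewrite ?act1.
have [b Gb bE] := Op.
have Vp : V p by have : (U `&` orbit G x) p by []; rewrite VE => -[].
have [S SE] : exists S : set A, V = \bigcup_(f in S) @basic_open k A f.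
  exact: Vop.
move: Vp; rewrite SE => -[f Sf /= pf].
exists (f * d a); split; last first.
  move=> q Oq; rewrite pointM mulf_eq0 negb_or => /andP[qf qa].
  split; last by exists a.
  have : (orbit G x `&` V) q by split=> //; rewrite SE; exists f.
  by rewrite -VE => -[].
have bf : act b x f != 0 by rewrite bE.
have [e [Ge ef ea]] := regular_irreducible char0 N_lnd (@regular_act _ _ N f x)
  (regular_act (d a) x) Gb Gc bf ca.
by exists e => //; have := mulf_neq0 ef ea; rewrite -pointM.
Qed.

Lemma generic_value x f b : G b -> act b x f != 0 ->
  gen [set c | act c x f != 0].
Proof. exact: (generic_neq0 (@regular_act _ _ N f x)). Qed.

Lemma generic_good d U x :
  (exists f, (exists2 b, G b & act b x f != 0) /\
    forall p, orbit G x p -> p f != 0 -> U p /\ moving d p) ->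
  gen [set c | U (act c x)].
Proof.
move=> [f [[b Gb bf] fU]].
apply: filterS (filterI (generic_value Gb bf) (generic_group N)) => c.
move=> [/= cf Gc].
by have [] := fU (act c x) _ cf; first by exists c.
Qed.

Lemma line_invariant d f x y : lnd d -> d f = 0 -> line d x y -> y f = x f.
Proof. by move=> d_lnd df [t _ <-]; rewrite invariant_exp. Qed.

(** Separating [y] from each [z] by some [f] in the kernel of [d], the product
    [F] of the [f - f z] is zero at all those [z], except where [d] vanishes,
    and nonzero at [y]; so the flow of [F d] does the job. *)
Lemma replica_move d U y t (zs : seq (points A)) :
  N d -> separated d U -> U y ->
  (forall z, z \in zs -> ~ moving d z \/ U z /\ line d z <> line d y) ->
  exists g, [/\ G g, forall z, z \in zs -> act g z = z &
    act g y = act (ex d t) y].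
Proof.
move=> Nd Usep Uy zsP; have d_lnd := N_lnd Nd; have [dM _] := d_lnd.
have [my|my] := pselect (moving d y); last first.
  by exists 1%g; split=> // [z _|]; rewrite act1 // not_moving_fixed.
have [F [dF yF zF]] : exists F, [/\ d F = 0, y F != 0 &
    forall z, z \in zs -> ~ moving d z \/ z F = 0].
  elim: zs zsP => [|z zs IHzs] zsP.
    by exists 1; split; rewrite ?deriv1 // rmorph1 oner_neq0.
  have [|F [dF yF zF]] := IHzs.
    by move=> w wzs; apply: zsP; rewrite inE wzs orbT.
  have [|nz|[Uz zy]] := zsP z; first by rewrite inE eqxx.
    by exists F; split=> // w; rewrite inE => /orP[/eqP->|/zF]; [left|].
  have [mz|nz] := pselect (moving d z); last first.
    by exists F; split=> // w; rewrite inE => /orP[/eqP->|/zF]; [left|].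
  have [f df fzy] := Usep z y Uz Uy mz my zy.
  exists (F * (f - (z f)%:A)); split.
  - rewrite dM dF mul0r add0r linearB df linearZ /= deriv1 //.
    by rewrite scaler0 subr0 mulr0.
  - rewrite pointM mulf_neq0 // pointB point_alg subr_eq0.
    by apply/eqP => yz; apply: fzy.
  - move=> w; rewrite inE => /orP[/eqP->|/zF[?|wF]].
    + by right; rewrite pointM pointB point_alg subrr mulr0.
    + by left.
    + by right; rewrite pointM wF mul0r.
have NF := sat_scale Nd dF.
have moveE s z : act (ex (scale_lnd F d) s) z = act (ex d (s * z F)) z.
  by apply: act_replica => //; exact: N_lnd.
exists (ex (scale_lnd F d) (t / y F)); split; first exact: Gex.
  move=> z /zF[nz|z0]; rewrite moveE; first exact: not_moving_fixed.
  by rewrite z0 mulr0 exp_aut0 // act1.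
by rewrite moveE divfK.
Qed.

(** * Invariants distinguish the points of an orbit *)

Section Indistinguishable.
Variables (d : {linear A -> A}) (Nd : N d) (q : points A).
Hypotheses (Oq : Omega q) (q_dim : krull_dim_ge (orbit G q) 2).
Hypothesis (q_moving : moves_orbit d q).
Let O := orbit G q.

(** Equivalently, the invariants of every conjugate of [d] agree at [x], [y]. *)
Definition indist x y := forall c f, G c -> d f = 0 -> act c x f = act c y f.

Let Oact g x : G g -> O x -> O (act g x).
Proof. by move=> Gg [h Gh <-]; exists (g * h)%g; [exact: GM|rewrite actM]. Qed.

Let O_Omega x : O x -> Omega x.
Proof. by move=> [h Gh <-]; exact: Omega_inv. Qed.

Let Ox_orbit x : O x -> orbit G x = O.
Proof. by move=> [h Gh <-]; rewrite orbit_act. Qed.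

Lemma indist_act g x y : G g -> indist x y -> indist (act g x) (act g y).
Proof. by move=> Gg xy c f Gc df; rewrite -!actM xy //; exact: GM. Qed.

Lemma indist_trans x y z : indist x y -> indist y z -> indist x z.
Proof. by move=> xy yz c f Gc df; rewrite xy // yz. Qed.

Lemma indist_sym x y : indist x y -> indist y x.
Proof. by move=> xy c f Gc df; rewrite xy. Qed.

Lemma indist_zclosed x : zclosed [set y | indist y x].
Proof.
move=> y yx c f Gc df; have := yx (c^-1%g f - (act c x f)%:A).
rewrite pointB point_alg -actE => /(_ _)/subr0_eq -> // z zx.
by rewrite pointB point_alg -actE zx // subrr.
Qed.

Lemma conj_flow g e t x : G g -> N e ->
  act (ex (conj_lnd g^-1%g e) t) x = act g^-1%g (act (ex e t) (act g x)).
Proof.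
move=> Gg Ne; have Nc := sat_conj (GV Gg) Ne.
by rewrite (exp_conj char0 t (N_lnd Ne) (N_lnd Nc)) invgK !actM.
Qed.

Lemma conj_line g e x p : G g -> N e ->
  line (conj_lnd g^-1%g e) x p <-> line e (act g x) (act g p).
Proof.
move=> Gg Ne; split=> -[t _ tE]; exists t => //.
  by rewrite -tE conj_flow // actVK.
by rewrite conj_flow // tE actK.
Qed.

Lemma conj_moving g e x : G g -> N e ->
  moving e (act g x) -> moving (conj_lnd g^-1%g e) x.
Proof.
by move=> Gg Ne [a ea]; exists (g^-1%g a); rewrite /conj_lnd /= aut_invK.
Qed.

(** Move [x] and [y] into the good locus of [d] by some [g]; by separation [y]
    lies on the line of the conjugate [e] of [d] through [x].  The flow of [e]
    that takes [x] to [y] preserves the class of [x], so its powers give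
    infinitely many points of the line in the class, and the closed class
    contains the line.  Conversely all points of the class near [x] are on this
    line by separation, hence its uniqueness. *)
Lemma indist_line x y : O x -> O y -> indist y x -> y <> x ->
  exists e, [/\ N e, moving e x, line e x `<=` [set z | indist z x] &
    forall e', N e' -> moving e' x -> line e' x `<=` [set z | indist z x] ->
      line e' x = line e x].
Proof.
move=> Ox Oy yx y_x; have d_lnd := N_lnd Nd.
have [U Usep /(_ q Oq q_moving)[f [[b Gb bf] fU]]] := separated_good Nd.
have genf z : O z -> gen [set c | act c z f != 0].
  move=> [h Gh <-]; have := generic_transl G1 Gh (generic_value Gb bf).
  exact: filterS.
have [g [[gx gy] Gg]] :=
  filter_ex (filterI (filterI (genf _ Ox) (genf _ Oy)) (generic_group N)).
have [Ugx mgx] := fU _ (Oact Gg Ox) gx; have [Ugy mgy] := fU _ (Oact Gg Oy) gy.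
pose e := conj_lnd g^-1%g d; have Ne : N e by apply: sat_conj => //; exact: GV.
have e_lnd := N_lnd Ne.
have lineP z : indist z x -> U (act g z) -> moving d (act g z) -> line e x z.
  move=> zx Uz mz; apply/conj_line => //.
  suff <- : line d (act g z) = line d (act g x) by exact: line_refl.
  apply: contrapT => /(Usep _ _ Uz Ugx mz mgx)[h dh]; apply.
  exact: zx.
have mx : moving e x by apply: conj_moving.
exists e; split=> // [|e' Ne' mx' sub].
  have [t _ tE] := lineP y yx Ugy mgy.
  apply: (line_sub_zclosed e_lnd (s := fun n : nat => n%:R * t)).
  - exact: indist_zclosed.
  - have t0 : t != 0.
      by apply/eqP => t0; apply: y_x; rewrite -tE t0 exp_aut0 // act1.
    by move=> m n /(mulIf t0)/(natr_inj char0).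
  - elim=> [|n IHn]; first by rewrite mul0r exp_aut0 // act1.
    rewrite -[n.+1]add1n natrD mulrDl mul1r exp_autD // actM /=.
    apply: indist_trans yx; rewrite -[in X in indist _ X]tE.
    by apply: indist_act => //; exact: Gex.
apply: line_sub_eq => //; first exact: N_lnd.
apply: (line_generic_sub (N_lnd Ne') (f := (g^-1)%g f) (p := x)).
- exact: line_zclosed.
- by apply: line_refl; exact: N_lnd.
- by rewrite -actE.
- move=> z xz; rewrite -actE => gz; have zx := sub _ xz.
  have Oz : O z by case: xz => t _ <-; apply: Oact => //; exact: Gex.
  by have [? ?] := fU _ (Oact Gg Oz) gz; exact: lineP.
Qed.

(** Move [x] by a generic [g] into the good locus of [e], and let [r] be a point
    near [x] on the line of [e1].  If [r] were not on the conjugate by [g] of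
    the line of [e], a replica would fix [r] and push [x] along that line; the
    equivalence of [x] and [r] would then put the whole line into the class of
    [x], and uniqueness in [indist_line] would make it the line of [e1], which
    contains [r].  Hence the two lines share infinitely many points. *)
Lemma indist_flow x y e e1 t : O x -> O y -> indist y x -> y <> x ->
  N e1 -> moving e1 x -> line e1 x `<=` [set z | indist z x] -> N e ->
  gen [set c | line e1 x (act (c^-1 * ex e t * c)%g x)].
Proof.
move=> Ox Oy yx y_x Ne1 mx sub1 Ne; have e_lnd := N_lnd Ne.
have e1_lnd := N_lnd Ne1.
have actE3 c :
    act (c^-1 * ex e t * c)%g x = act c^-1%g (act (ex e t) (act c x)).
  by rewrite !actM.
have [mov|nomov] := pselect (moves_orbit e x); last first.
  apply: filterS (generic_group N) => c Gc /=.
  rewrite actE3 not_moving_fixed //.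
    by rewrite actK; exact: line_refl.
  by move=> mc; apply: nomov; exists c.
have [U Usep /(_ x (O_Omega Ox) mov)[f [[b Gb bf] fU]]] := separated_good Ne.
apply: filterS (filterI (generic_value Gb bf) (generic_group N)) => g.
move=> [/= gx Gg].
rewrite Ox_orbit // in fU.
pose e2 := conj_lnd g^-1%g e.
have Ne2 : N e2 by apply: sat_conj => //; exact: GV.
have [Ugx mgx] := fU _ (Oact Gg Ox) gx.
have mx2 : moving e2 x by apply: conj_moving.
have [e0 [Ne0 mx0 sub0 uniq0]] := indist_line Ox Oy yx y_x.
have -> : line e1 x = line e2 x; last first.
  by rewrite actE3 -conj_flow //; exists t.
apply: line_sub_eq => //; first exact: N_lnd.
apply: (line_generic_sub e1_lnd (f := (g^-1)%g f) (p := x)).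
- by apply: line_zclosed; exact: N_lnd.
- exact: line_refl.
- by rewrite -actE.
move=> r xr; rewrite -actE => gr.
have Or : O r by case: xr => s _ <-; apply: Oact => //; exact: Gex.
have [Ugr mgr] := fU _ (Oact Gg Or) gr.
apply: contrapT => nr.
suff sub2 : line e2 x `<=` [set z | indist z x].
  by apply: nr; rewrite (uniq0 e2) // -(uniq0 e1).
move=> _ [s _ <-] /=; rewrite conj_flow // -[x in indist _ x](actK g).
have gr_gx : indist (act g r) (act g x) by apply: indist_act => //; exact: sub1.
apply: indist_act; first exact: GV.
have [|h [Gh hr hx]] := replica_move s (zs := [:: act g r]) Ne Usep Ugx.
  move=> z; rewrite inE => /eqP->; right; split=> // grgx.
  apply/nr/conj_line => //.
  by rewrite -grgx; exact: line_refl.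
rewrite -hx; apply: indist_trans gr_gx; rewrite -(hr (act g r)) ?inE //.
apply: indist_act => //; apply: indist_sym.
by apply: indist_act => //; exact: sub1.
Qed.

(** Otherwise the line [D] through [q] in the class of [q] is also the line of
    each of its points.  By [indist_flow] the set of [g] taking [q] into [D] is
    stable under generic conjugates of the flows, so it is dense; [D] being
    closed, it contains the orbit, of dimension at least 2. *)
Lemma indist_eq p : O p -> indist p q -> p = q.
Proof.
move=> Op pq; apply: contrapT => p_q.
have Oself : O q by exists 1%g; rewrite ?act1.
have [e [Ne mq sub _]] := indist_line Oself Op pq p_q.
have e_lnd := N_lnd Ne.
pose K := [set g | G g /\ line e q (act g q)].
apply: (line_dim_lt2 e_lnd _ q_dim (x := q)) => _ [g Gg <-].
apply: contrapT => ngq.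
have [f fE gf] := zclosed_separate (@line_zclosed _ char0 _ _ e_lnd q) ngq.
have [|||h [Gh /fE hq]] :=
  @generic_dense _ char0 _ N N_lnd K _ _ _ _ (generic_value Gg gf).
- by split=> //; rewrite act1; exact: line_refl.
- move=> h e' t [Gh hq] Ne'.
  set x := act h q in hq.
  have Ox : O x by exists h.
  have xq : indist x q by exact: sub.
  have [y [Oy yx y_x]] : exists y, [/\ O y, indist y x & y <> x].
    have [xE|x_q] := pselect (x = q); first by exists p; rewrite xE.
    by exists q; split=> //; [exact: indist_sym|exact: nesym].
  have lineE := line_trans e_lnd hq.
  have subx : line e x `<=` [set z | indist z x].
    by rewrite lineE => z /sub zq; apply: indist_trans zq _; exact: indist_sym.
  have := indist_flow t Ox Oy yx y_x Ne (moving_line e_lnd hq mq) subx Ne'.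
  rewrite lineE => flow.
  apply: filterS (filterI flow (generic_group N)) => c [/= ? Gc].
  split; last by rewrite actM.
  by apply: GM => //; apply: lnd_group_conj => //; exact: Gex.
- by move=> h [].
- by move=> /eqP; apply.
Qed.

End Indistinguishable.

(** * Transitivity of stabilisers *)

Definition fixes (zs : seq (points A)) g :=
  G g /\ forall z, z \in zs -> act g z = z.

Lemma fixes1 zs : fixes zs 1%g.
Proof. by split=> // z _; rewrite act1. Qed.

Lemma fixesM zs g h : fixes zs g -> fixes zs h -> fixes zs (g * h)%g.
Proof.
move=> [Gg gz] [Gh hz]; split; first exact: GM.
by move=> z zzs; rewrite actM hz // gz.
Qed.

Lemma fixesV zs g : fixes zs g -> fixes zs g^-1%g.
Proof.
by move=> [Gg gz]; split; [exact: GV|move=> z zzs; rewrite -{1}(gz z zzs) actK].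
Qed.

Lemma generic_all (zs : seq (points A)) (P : points A -> set (algAut A)) :
  (forall z, z \in zs -> gen (P z)) ->
  gen [set c | forall z, z \in zs -> P z c].
Proof.
elim: zs => [|z zs IHzs] zsP; first by apply: filterE.
have Pz : gen (P z) by apply: zsP; rewrite inE eqxx.
have Pzs : gen [set c | forall z, z \in zs -> P z c].
  by apply: IHzs => w wzs; apply: zsP; rewrite inE wzs orbT.
apply: filterS (filterI Pz Pzs) => c [/= zc zsc] w.
by rewrite inE => /orP[/eqP->//|/zsc].
Qed.

Definition big_orbit y := Omega y /\ krull_dim_ge (orbit G y) 2.

Lemma big_orbit_act g y : G g -> big_orbit y -> big_orbit (act g y).
Proof.
by move=> Gg [Oy y_dim]; split; [exact: Omega_inv|rewrite orbit_act].
Qed.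

(** For generic [c], the point [c y] and the points of [c zs] that lie on orbits
    moved by [d] are in the good loci of [d], and by [indist_eq] the line
    through [c y] differs from the others; so [replica_move] applies to them. *)
Lemma generic_replica_move d t y zs : N d -> big_orbit y ->
  (forall z, z \in zs -> Omega z) -> y \notin zs ->
  gen [set c | exists2 g, fixes zs g & act g y = act (c^-1 * ex d t * c)%g y].
Proof.
move=> Nd [Oy y_dim] zsO yzs; have d_lnd := N_lnd Nd.
have [mov|nomov] := pselect (moves_orbit d y); last first.
  apply: filterS (generic_group N) => c Gc /=; exists 1%g; first exact: fixes1.
  rewrite !actM not_moving_fixed ?actK ?act1 // => mc.
  by apply: nomov; exists c.
have [U Usep Ugood] := separated_good Nd.
have genU z : Omega z -> moves_orbit d z -> gen [set c | U (act c z)].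
  by move=> Oz zmov; apply/generic_good/Ugood.
have genz : gen [set c | forall z, z \in zs -> ~ moving d (act c z) \/
    U (act c z) /\ line d (act c z) <> line d (act c y)].
  apply: generic_all => z zzs.
  have [zmov|nozmov] := pselect (moves_orbit d z); last first.
    apply: filterS (generic_group N) => c Gc; left=> mc.
    by apply: nozmov; exists c.
  suff lineN : gen [set c | line d (act c z) <> line d (act c y)].
    apply: filterS (filterI (genU z (zsO z zzs) zmov) lineN) => c.
    by move=> [? ?]; right.
  have [Oz|nOz] := pselect (orbit G y z); last first.
    apply: filterS (generic_group N) => c Gc /= zy; apply: nOz.
    have : line d (act c y) (act c z) by rewrite -zy; exact: line_refl.
    move=> [s _ sE]; exists (c^-1 * ex d s * c)%g.
      by apply: lnd_group_conj => //; exact: Gex.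
    by rewrite !actM sE actK.
  have /existsNP[c /existsNP[f /not_implyP[Gc /not_implyP[df /eqP zy]]]] :
      ~ indist d z y.
    move=> zy; have zE := indist_eq Nd Oy y_dim mov Oz zy.
    by rewrite -zE zzs in yzs.
  have rzy : regular N (fun c => act c z f - act c y f).
    by apply: regularB; exact: regular_act.
  have zy0 : act c z f - act c y f != 0 by rewrite subr_eq0.
  apply: filterS (generic_neq0 rzy Gc zy0) => h /=.
  rewrite subr_eq0 => /eqP hzy lzy.
  have hz : line d (act h y) (act h z) by rewrite -lzy; exact: line_refl.
  exact/hzy/(line_invariant d_lnd df hz).
apply: filterS (filterI (filterI (genU y Oy mov) genz) (generic_group N)) => c.
move=> [[/= Uy zsP] Gc].
have [|g [Gg gz gy]] := replica_move t (zs := map (act c) zs) Nd Usep Uy.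
  by move=> _ /mapP[z zzs ->]; exact: zsP.
exists (c^-1 * g * c)%g; last by rewrite !actM gy.
split; first exact: lnd_group_conj.
by move=> z zzs; rewrite !actM gz ?actK //; exact: map_f.
Qed.

(** The set [K] of the [h] that act on [y] like some element of the stabiliser
    of [zs] satisfies the hypotheses of [generic_dense]. *)
Lemma fixes_dense y zs P : big_orbit y -> (forall z, z \in zs -> Omega z) ->
  y \notin zs -> gen P -> exists h g, [/\ P h, fixes zs g & act h y = act g y].
Proof.
move=> By zsO yzs genP.
pose K := [set h | G h /\ exists2 g, fixes zs g & act h y = act g y].
have [|||h [Gh [g gzs hy]] Ph] :=
  @generic_dense _ char0 _ N N_lnd K P _ _ _ genP.
- by split=> //; exists 1%g; first exact: fixes1.
- move=> h d t [Gh [g gzs hy]] Nd; have [Gg gz] := gzs.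
  have gyzs : act g y \notin zs.
    apply: contra yzs => gyzs; rewrite -(actK g y).
    by rewrite (fixesV gzs).2.
  have := generic_replica_move t Nd (big_orbit_act Gg By) zsO gyzs.
  move=> flow.
  apply: filterS (filterI flow (generic_group N)) => c [/= [g' g'zs g'y] Gc].
  split; first by apply: GM => //; apply: lnd_group_conj => //; exact: Gex.
  by exists (g' * g)%g; [exact: fixesM|rewrite [RHS]actM g'y -hy -actM].
- by move=> h [].
by exists h, g.
Qed.

(** The [g] with this property form a subgroup [P], because generic sets are
    stable under translation.  If [c zs] lies in the good loci of [d], then
    c^-1 exp(t d) c is in [P], as a generic point of the orbit of [y] is off the
    finitely many lines of [d] through [c zs].  So [P] contains the generic
    conjugates of the flows and is dense; hence [c] can be chosen in [P] itself,
    and then exp(t d) is in [P] too. *)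
Lemma generic_fixes_transitive y zs g : big_orbit y ->
  (forall z, z \in zs -> Omega z) -> G g ->
  gen [set c | exists2 h, fixes zs h & act h (act c y) = act g (act c y)].
Proof.
move=> [Oy y_dim] zsO.
pose P := [set g | G g /\
  gen [set c | exists2 h, fixes zs h & act h (act c y) = act g (act c y)]].
have P1 : P 1%g.
  by split=> //; apply: filterE => c; exists 1%g; first exact: fixes1.
have PM g1 g2 : P g1 -> P g2 -> P (g1 * g2)%g.
  move=> [Gg1 gen1] [Gg2 gen2]; split; first exact: GM.
  have := generic_transl Gg2 G1 gen1 => gen1'.
  apply: filterS (filterI gen1' gen2) => c [/= [h1 h1zs h1E] [h2 h2zs h2E]].
  exists (h1 * h2)%g; first exact: fixesM.
  by move: h1E; rewrite mulg1 actM => h1E; rewrite !actM h2E.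
have PV g1 : P g1 -> P g1^-1%g.
  move=> [Gg1 gen1]; split; first exact: GV.
  have := generic_transl (GV Gg1) G1 gen1.
  apply: filterS => c /= [h hzs]; rewrite mulg1 actM actVK => hE.
  by exists h^-1%g; [exact: fixesV|rewrite -{1}hE actK].
suff PN d t : N d -> P (ex d t).
  suff GP : G `<=` P by move=> /GP[].
  apply: (@lnd_group_ind _ char0 _ _ N_lnd) => // [h1 h2 _ _|h _].
    exact: PM.
  exact: PV.
move=> Nd; have d_lnd := N_lnd Nd.
have good e : N e -> exists2 V, gen V & forall c s, G c -> V c ->
    P (c^-1 * ex e s * c)%g.
  move=> Ne; have e_lnd := N_lnd Ne.
  have [U Usep Ugood] := separated_good Ne.
  exists [set c | forall z, z \in zs -> ~ moving e (act c z) \/ U (act c z)].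
    apply: generic_all => z zzs.
    have [mov|nomov] := pselect (moves_orbit e z); last first.
      apply: filterS (generic_group N) => c Gc; left=> mc.
      by apply: nomov; exists c.
    by apply: filterS (generic_good (Ugood z (zsO z zzs) mov)) => c; right.
  move=> c s Gc zsP; split; first by apply: lnd_group_conj => //; exact: Gex.
  have [mov|nomov] := pselect (moves_orbit e y); last first.
    apply: filterS (generic_group N) => b Gb /=.
    exists 1%g; first exact: fixes1.
    rewrite !actM not_moving_fixed ?actK ?act1 // -actM => mc.
    by apply: nomov; exists (c * b)%g; first exact: GM.
  have genUy := generic_transl Gc G1 (generic_good (Ugood y Oy mov)).
  have genz : gen [set b | forall z, z \in zs ->
      line e (act c z) <> line e (act (c * b * 1)%g y)].
    apply: generic_all => z zzs.
    have [p Op pz] : exists2 p, orbit G y p & ~ line e (act c z) p.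
      apply: contrapT => no.
      apply: (line_dim_lt2 e_lnd _ y_dim (x := act c z)) => p Op.
      by apply: contrapT => pz; apply: no; exists p.
    have [f fE pf] := zclosed_separate (@line_zclosed _ char0 _ _ e_lnd _) pz.
    have [a Ga aE] := Op; rewrite -aE in pf.
    apply: filterS (generic_transl Gc G1 (generic_value Ga pf)) => h /= hf lE.
    have /fE hf0 : line e (act c z) (act (c * h * 1)%g y).
      by rewrite lE; exact: line_refl.
    by move/eqP: hf; apply.
  apply: filterS (filterI genUy genz) => h [/= Uh hz].
  have [|g' [Gg' g'z g'y]] := replica_move s (zs := map (act c) zs) Ne Usep Uh.
    move=> _ /mapP[z zzs ->]; have [|Uz] := zsP z zzs; first by left.
    by right; split=> //; exact: hz.
  exists (c^-1 * g' * c)%g; last first.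
    by move: g'y; rewrite mulg1 actM => g'y; rewrite !actM g'y.
  split; first exact: lnd_group_conj.
  by move=> z zzs; rewrite !actM g'z ?actK //; exact: map_f.
have [V genV VP] := good d Nd.
have [||c [Gc Pc] Vc] := @generic_dense _ char0 _ N N_lnd P V P1 _ _ genV.
- move=> h e s Ph Ne; have [W genW WP] := good e Ne.
  apply: filterS (filterI genW (generic_group N)) => c [Wc Gc].
  by apply: PM => //; exact: WP.
- by move=> h [].
have -> : ex d t = (c * (c^-1 * ex d t * c) * c^-1)%g.
  by rewrite !mulgA mulgV mul1g mulgK.
by apply: (PM); [apply: PM => //; exact: VP|exact: PV].
Qed.

(** If [c] fixes both [zs] and [g^-1 zs], then [g * c * g^-1] fixes [zs] and
    takes [w = g y] to [g (c y)]; so it is enough to find such a [c] for which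
    [g (c y)] is in the orbit of [c y] under the stabiliser of [zs].  This is a
    generic condition on [c], and density supplies the [c]. *)
Lemma fixes_transitive y w zs :
  big_orbit y -> (forall z, z \in zs -> Omega z) ->
  orbit G y w -> y \notin zs -> w \notin zs ->
  exists2 g, fixes zs g & act g y = w.
Proof.
move=> By zsO [g Gg gy] yzs wzs.
pose zs' := zs ++ map (act g^-1%g) zs.
have zs'O z : z \in zs' -> Omega z.
  rewrite mem_cat => /orP[/zsO //|/mapP[z' z'zs ->]].
  by apply: Omega_inv; [exact: GV|exact: zsO].
have yzs' : y \notin zs'.
  rewrite mem_cat negb_or yzs; apply: contra wzs => /mapP[z zzs yz].
  by rewrite -gy yz actVK.
have [h [c [[h2 h2zs h2E] [Gc cz] hc]]] :=
  fixes_dense By zs'O yzs' (generic_fixes_transitive By zsO Gg).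
have czs : fixes zs c by split=> // z zzs; apply: cz; rewrite mem_cat zzs.
have gczs : fixes zs (g * c * g^-1)%g.
  split; first by apply: GM; [exact: GM|exact: GV].
  by move=> z zzs; rewrite !actM cz ?actVK // mem_cat map_f ?orbT.
exists ((g * c * g^-1)^-1 * h2 * c)%g.
  by apply: fixesM => //; apply: fixesM => //; exact: fixesV.
rewrite !actM -hc h2E hc -gy.
by apply: (@act_inj _ _ (g * c * g^-1)%g); rewrite actVK !actM actK.
Qed.

End Separation.

(** * Infinite transitivity *)

Theorem theorem3p1 (k : closedFieldType) (char0 : [pchar k] =i pred0)
  (A : comAlgType k)
  (A_fg : finitely_generated A) (A_reduced : reduced A)
  (X_irr : irreducible [set: points A])
  (N : set {linear A -> A}) (G : set (algAut A))
  (G_sub : G `<=` @SAut k A)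
  (G_gen : G = lnd_group N)
  (N_sat : saturated N)
  (Omega : set (points A)) (Omega_inv : stable G Omega)
  (N_sep : forall d, N d -> orbit_separation G Omega d)
  (m : nat) (x x' : 'I_m -> points A)
  (x_in : forall j, Omega (x j)) (x'_in : forall j, Omega (x' j))
  (x_inj : injective x) (x'_inj : injective x')
  (x_orbit : forall j, orbit G (x j) = orbit G (x' j))
  (x_dim : forall j, krull_dim_ge (orbit G (x j)) 2) :
  exists2 g, G g & forall j, act g (x j) = x' j.
Proof.
subst G; set G := lnd_group N in Omega_inv N_sep x_orbit x_dim *.
have GM := @lnd_groupM k A N; have G1 := @lnd_group1 k A N.
suff /(_ m (leqnn m))[g Gg gx] : forall n, (n <= m)%N ->
    exists2 g, G g & forall j : 'I_m, (j < n)%N -> act g (x j) = x' j.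
  by exists g => // j; apply: gx.
elim=> [|n IHn] nm; first by exists 1%g.
have [g Gg gx] := IHn (ltnW nm); pose i := Ordinal nm.
pose zs := [seq x' j | j : 'I_m <- enum 'I_m & (j < n)%N].
have zsP z : z \in zs -> exists2 j : 'I_m, (j < n)%N & z = x' j.
  by move=> /mapP[j]; rewrite mem_filter => /andP[jn _] ->; exists j.
have [|z /zsP[j _ ->] //||||h [Gh hz] hx] :=
  fixes_transitive char0 N_sat Omega_inv N_sep
    (y := act g (x i)) (w := x' i) (zs := zs).
- by split; [exact: Omega_inv|rewrite orbit_act].
- rewrite orbit_act // x_orbit; exists 1%g => //.
  by apply: lrmorphism_eq.
- apply/negP => /zsP[j jn]; rewrite -gx // => /act_inj /x_inj ij.
  by move: jn; rewrite -ij ltnn.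
- by apply/negP => /zsP[j jn] /x'_inj ij; move: jn; rewrite -ij ltnn.
exists (h * g)%g => [|j]; first exact: GM.
rewrite ltnS leq_eqVlt actM => /orP[/eqP jn|jn].
  by have -> : j = i by apply: val_inj.
rewrite gx //; apply: hz; apply: map_f.
by rewrite mem_filter jn mem_enum.
Qed.
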